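(* Let $m,n\ge 1$, let $P_m$ and $P_n$ be path graphs on $m$ and $n$ vertices, and let $P_m\vee_a P_n$ be the wedge of $P_m$ and $P_n$ obtained by identifying an arbitrary vertex of $P_m$ with an arbitrary vertex of $P_n$ into a single vertex $a$. Then the independence complex $\mathcal{I}(P_m\vee_a P_n)$ is either contractible or homotopy equivalent to a sphere.
   Context: The path graph $P_l$ has vertices $1,\dots,l$ with edges $\{i,i+1\}$. Given finite simple graphs $G_1=(V_1,E_1)$, $G_2=(V_2,E_2)$ and vertices $a_1\in V_1$, $a_2\in V_2$, the wedge $G_1\vee_a G_2$ is the graph obtained from the disjoint union by identifying $a_1$ and $a_2$ to a single vertex $a$: its vertex set is $(V_1\setminus\{a_1\})\cup(V_2\setminus\{a_2\})\cup\{a\}$, and its edges are the edges of $G_1,G_2$ not incident to $a_1,a_2$ together with edges $ab$ for every edge $a_ib$ of $G_i$. The independence complex $\mathcal{I}(G)$ is the simplicial complex whose simplices are the independent vertex sets of $G$. *)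

(* Defs.v *)
From HB Require Import structures.
From mathcomp Require Import all_boot all_order all_algebra.
From mathcomp Require Import all_classical all_reals all_analysis.

Set Implicit Arguments.
Unset Strict Implicit.
Unset Printing Implicit Defensive.

Import Order.TTheory GRing.Theory Num.Theory.
Import numFieldNormedType.Exports.

Local Open Scope classical_set_scope.
Local Open Scope ring_scope.

Record sgraph := SGraph {
  vertex :> finType;
  adj : rel vertex;
  adj_sym : symmetric adj;
  adj_irrefl : irreflexive adj
}.

(* The vertices 1, ..., l are renumbered 0, ..., l - 1. *)
Definition path_adj (l : nat) : rel 'I_l :=
  fun i j => (i.+1 == j :> nat) || (j.+1 == i :> nat).

Lemma path_adj_sym l : symmetric (@path_adj l).
Proof. by move=> i j; rewrite /path_adj orbC. Qed.

Lemma path_adj_irrefl l : irreflexive (@path_adj l).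
Proof. by move=> i; rewrite /path_adj orbb gtn_eqF. Qed.

Definition path_graph (l : nat) : sgraph :=
  SGraph (@path_adj_sym l) (@path_adj_irrefl l).

Section Wedge.
Variables (G1 G2 : sgraph) (a1 : G1) (a2 : G2).

(* [None] is the vertex a obtained by identifying a1 and a2. *)
Definition wedge_vertex : finType :=
  option ({x : G1 | x != a1} + {y : G2 | y != a2})%type.

Definition wedge_adj : rel wedge_vertex := fun u v =>
  match u, v with
  | None, None => false
  | None, Some (inl y) => adj a1 (val y)
  | None, Some (inr y) => adj a2 (val y)
  | Some (inl x), None => adj (val x) a1
  | Some (inr x), None => adj (val x) a2
  | Some (inl x), Some (inl y) => adj (val x) (val y)
  | Some (inr x), Some (inr y) => adj (val x) (val y)
  | Some (inl _), Some (inr _) => false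
  | Some (inr _), Some (inl _) => false
  end.

Lemma wedge_adj_sym : symmetric wedge_adj.
Proof. by move=> [[x|x]|] [[y|y]|] //=; rewrite adj_sym. Qed.

Lemma wedge_adj_irrefl : irreflexive wedge_adj.
Proof. by move=> [[x|x]|] //=; rewrite adj_irrefl. Qed.

Definition wedge_graph : sgraph := SGraph wedge_adj_sym wedge_adj_irrefl.

End Wedge.

Arguments wedge_graph G1 G2 a1 a2 : clear implicits.

(* The empty set may or may not be a simplex; it contributes no point to the
   geometric realization. *)
Record scomplex (V : finType) := SComplex {
  simplices :> {set {set V}};
  simplices_sub : forall A B : {set V},
    B \in simplices -> A \subset B -> A \in simplices
}.

Definition independent (G : sgraph) (A : {set G}) : bool :=
  [forall u in A, forall v in A, ~~ adj u v].

Lemma independent_sub (G : sgraph) (A B : {set G}) :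
  B \in [set S : {set G} | independent S]%SET -> A \subset B ->
  A \in [set S : {set G} | independent S]%SET.
Proof.
rewrite !inE => /forall_inP iB /fintype.subsetP sAB.
apply/forall_inP => u /sAB uB; apply/forall_inP => v /sAB vB.
by have /forall_inP := iB u uB; apply.
Qed.

Definition independence_complex (G : sgraph) : scomplex G :=
  SComplex (@independent_sub G).

(* Barycentric coordinates in R^V; as V is finite, the subspace topology is
   the usual (coherent) topology of the realization. *)
Definition realization_set (R : realType) (V : finType) (K : scomplex V) :
    set {ptws V -> R} :=
  [set x | [/\ forall v, 0 <= x v,
               \sum_(v : V) x v = 1 &
               [set v : V | x v != 0]%SET \in (K : {set {set V}})]].

Definition realization (R : realType) (V : finType) (K : scomplex V) :
    topologicalType :=
  set_type (@realization_set R V K).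
Arguments realization R {V} K.

Definition sphere (R : realType) (d : nat) : topologicalType :=
  set_type [set x : 'rV[R]_d.+1 | \sum_(i < d.+1) x ord0 i ^+ 2 = 1].

(* The values of H outside X x [0, 1] are irrelevant. *)
Definition homotopic (R : realType) (X Y : topologicalType) (f g : X -> Y) :=
  exists H : X * R -> Y,
    [/\ {within [set: X] `*` `[0, 1], continuous H},
        forall x, H (x, 0) = f x &
        forall x, H (x, 1) = g x].

Definition homotopy_equivalent (R : realType) (X Y : topologicalType) :=
  exists (f : X -> Y) (g : Y -> X),
    [/\ continuous f, continuous g,
        homotopic R (g \o f) idfun & homotopic R (f \o g) idfun].

Definition contractible (R : realType) (X : topologicalType) :=
  exists x0 : X, homotopic R idfun (cst x0 : X -> X).

(* Main.v *)
(** The wedge of two paths is a tree: ranking the vertices by their distance to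
the wedge point, neighbours have distinct ranks and every vertex has at most
one neighbour of smaller rank.

If N(u) is contained in N(v) for distinct vertices u and v, then moving the
barycentric weight of v to u along straight lines deformation retracts the
independence complex onto that of the graph without v. Among the vertices of
degree at least 2, one of maximal rank has a neighbour u of larger rank, which
is a leaf, so every other neighbour v of this vertex can be deleted in this
way. Once all degrees are at most 1, either some vertex is isolated and the
complex is a cone, or the graph is a perfect matching and the complex is the
boundary of a cross-polytope, i.e. the unit sphere of the l1 norm. *)
Require Import Defs.
From mathcomp Require Import all_boot all_order all_algebra.
From mathcomp Require Import all_classical all_reals all_analysis.
From mathcomp Require Import ring lra zify.

Set Implicit Arguments.
Unset Strict Implicit.
Unset Printing Implicit Defensive.

Import Order.TTheory GRing.Theory Num.Theory.
Import numFieldNormedType.Exports.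

Local Open Scope classical_set_scope.
Local Open Scope ring_scope.

(** * Continuity and homotopy *)

Lemma continuous_compose (X Y Z : topologicalType) (f : X -> Y) (g : Y -> Z) :
  continuous f -> continuous g -> continuous (fun x => g (f x)).
Proof. by move=> cf cg x; apply: continuous_comp; [exact: cf|exact: cg]. Qed.

Lemma continuous_pair (T X Y : topologicalType) (f : T -> X) (g : T -> Y) :
  continuous f -> continuous g -> continuous (fun t => (f t, g t)).
Proof.
move=> cf cg t.
exact: (@cvg_pair _ _ _ _ (nbhs (f t)) (nbhs (g t)) _ _ _ _ _ (cf t) (cg t)).
Qed.

Lemma continuous_fst (X Y : topologicalType) : continuous (@fst X Y).
Proof. by move=> p; exact: cvg_fst. Qed.

Lemma continuous_snd (X Y : topologicalType) : continuous (@snd X Y).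
Proof. by move=> p; exact: cvg_snd. Qed.

Section Continuity.
Context {R : realType}.

Lemma continuous_into_ptws (T : topologicalType) (V : choiceType)
    (f : T -> {ptws V -> R}) :
  (forall v, continuous (fun t => f t v)) -> continuous f.
Proof.
move=> cf t; apply/cvg_sup => v.
exact: (@continuous_comp_initial _ _ _ (proj v) f (cf v)).
Qed.

Lemma continuous_into_set_type (T X : topologicalType) (A : set X)
    (f : T -> set_type A) :
  continuous (fun t => val (f t)) -> continuous f.
Proof. exact: continuous_comp_initial. Qed.

Lemma continuous_set_val (X : topologicalType) (A : set X) :
  continuous (val : set_type A -> X).
Proof. exact: initial_continuous. Qed.

Lemma continuous_coordinate (V : finType) (K : scomplex V) (v : V) :
  continuous (fun x : realization R K => val x v : R).
Proof.
move=> x.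
apply: (@continuous_comp (realization R K) {ptws V -> R} R
  (fun x => val x) (fun f => f v) x).
  exact: continuous_set_val.
exact: (@proj_continuous V (fun=> R) v).
Qed.

Lemma continuous_into_realization (T : topologicalType) (V : finType)
    (K : scomplex V) (f : T -> realization R K) :
  (forall v, continuous (fun t => val (f t) v : R)) -> continuous f.
Proof.
by move=> cf; apply: continuous_into_set_type; apply: continuous_into_ptws.
Qed.

Lemma continuous_into_rV (T : topologicalType) d (f : T -> 'rV[R]_d) :
  (forall i, continuous (fun t => f t ord0 i)) -> continuous f.
Proof.
move=> cf t; apply/cvg_mx_entourageP => A eA.
have near_coord i : \forall s \near t, A (f t ord0 i, f s ord0 i).
  by move: A eA; apply/cvg_app_entourageP; exact: (cf i t).
apply: (@filterS T (nbhs t) _ (fun s => forall i, A (f t ord0 i, f s ord0 i))).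
  by move=> s As i j; rewrite (ord1 i) inE; exact: As.
exact: filter_forall.
Qed.

(** The retraction of the real line onto [0, 1], used to freeze homotopies outside that interval. *)
Definition clamp (t : R) : R := Num.max 0 (Num.min 1 t).

Lemma clamp_ge0 t : 0 <= clamp t.
Proof. by rewrite /clamp le_max lexx. Qed.

Lemma clamp_le1 t : clamp t <= 1.
Proof. by rewrite /clamp ge_max ler01 ge_min lexx. Qed.

Lemma clampE t : 0 <= t <= 1 -> clamp t = t.
Proof. by move=> /andP[t0 t1]; rewrite /clamp min_r // max_r. Qed.

Lemma clamp_continuous : continuous clamp.
Proof.
move=> t; apply: continuous_max; first exact: cst_continuous.
apply: continuous_min; [exact: cst_continuous|exact: cvg_id].
Qed.

(** Precomposing with [clamp] in the time variable extends a homotopy continuously to all of X x R,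
    so that homotopies can be handled as globally continuous maps. *)
Lemma homotopicP (X Y : topologicalType) (f g : X -> Y) :
  homotopic R f g <->
  exists H : X * R -> Y, [/\ continuous H,
    forall x, H (x, 0) = f x & forall x, H (x, 1) = g x].
Proof.
split=> [[H [cH H0 H1]]|[H [cH H0 H1]]]; last first.
  by exists H; split=> //; exact: continuous_subspaceT.
exists (fun p => H (p.1, clamp p.2)); split=> [|x|x]; last 2 first.
- by rewrite clampE ?lexx ?ler01 //= H0.
- by rewrite clampE ?lexx ?ler01 //= H1.
move=> p; have /subspace_continuousP cH' := cH.
have cl : ([set: X] `*` `[0, 1]) (p.1, clamp p.2).
  by split=> //=; rewrite in_itv /= clamp_ge0 clamp_le1.
have cp : (fun p : X * R => (p.1, clamp p.2)) @ p --> (p.1, clamp p.2).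
  apply: continuous_pair; first exact: continuous_fst.
  exact: continuous_compose (@continuous_snd _ _) clamp_continuous.
apply: (@cvg_comp _ _ _ (fun p : X * R => (p.1, clamp p.2)) H _ _ _ _ (cH' _ cl)).
move=> U wU; have := cp _ wU.
apply: (@filterS _ (nbhs p)) => q /= qU; apply: qU; split => //=.
by rewrite in_itv /= clamp_ge0 clamp_le1.
Qed.

Lemma homotopic_refl (X Y : topologicalType) (f : X -> Y) :
  continuous f -> homotopic R f f.
Proof.
move=> cf; apply/homotopicP; exists (f \o fst); split=> //.
exact: continuous_compose (@continuous_fst _ _) cf.
Qed.

Lemma homotopic_sym (X Y : topologicalType) (f g : X -> Y) :
  homotopic R f g -> homotopic R g f.
Proof.
move=> /homotopicP[H [cH H0 H1]]; apply/homotopicP.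
exists (fun p : X * R => H (p.1, 1 - p.2)); split=> [|x|x] /=; last 2 first.
- by rewrite subr0.
- by rewrite subrr.
apply: continuous_compose cH; apply: continuous_pair.
  exact: continuous_fst.
by move=> p; apply: cvgB; [exact: cvg_cst|exact: cvg_snd].
Qed.

Lemma homotopic_trans (X Y : topologicalType) (f g h : X -> Y) :
  homotopic R f g -> homotopic R g h -> homotopic R f h.
Proof.
move=> /homotopicP[H [cH H0 H1]] /homotopicP[H' [cH' H'0 H'1]].
apply/homotopicP.
(* The offset [b] is 0 on the first half of the time interval and 1 on the second, so one claim
   serves both halves. *)
have cont_reparam (G : X * R -> Y) (b : R) : continuous G ->
    continuous (fun p : X * R => G (p.1, 2 * p.2 - b)).
  move=> cG; apply: continuous_compose cG; apply: continuous_pair.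
    exact: continuous_fst.
  move=> p; apply: cvgB; last exact: cvg_cst.
  by apply: cvgM; [exact: cvg_cst|exact: cvg_snd].
exists (fun p : X * R => if p.2 <= 2^-1 then H (p.1, 2 * p.2 - 0)
                 else H' (p.1, 2 * p.2 - 1)).
split=> [|x|x] /=; last 2 first.
- by rewrite invr_ge0 ler0n mulr0 subr0.
- have -> : (1 : R) <= 2^-1 = false by lra.
  by rewrite (_ : 2 * 1 - 1 = 1 :> R) //; lra.
(* Pasting along two closed half-spaces: they meet at time 1/2, where both formulas give [g]. *)
apply/continuous_subspace_setT.
rewrite (_ : setT = [set p : X * R | p.2 <= (2^-1 : R)] `|`
                    [set p : X * R | (2^-1 : R) <= p.2]); last first.
  apply/seteqP; split=> // p _ /=; case: (leP p.2 2^-1) => [|/ltW]; by [left|right].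
apply: withinU_continuous.
- apply: (@preimage_closed (X * R)%type R snd [set x : R | x <= 2^-1]).
    by move=> p _; exact: continuous_snd.
  exact: closed_le.
- apply: (@preimage_closed (X * R)%type R snd [set x : R | 2^-1 <= x]).
    by move=> p _; exact: continuous_snd.
  exact: closed_ge.
- apply: (@subspace_eq_continuous _ _ _ (fun p : X * R => H (p.1, 2 * p.2 - 0))).
    by move=> p /set_mem /= p2; rewrite /from_subspace p2.
  by apply: continuous_subspaceT; exact: cont_reparam.
- apply: (@subspace_eq_continuous _ _ _ (fun p : X * R => H' (p.1, 2 * p.2 - 1))).
    move=> p /set_mem /= p2; rewrite /from_subspace; case: ifPn => // p2'.
    have -> : p.2 = 2^-1 by apply/le_anti; rewrite p2 p2'.
    by rewrite subr0 mulfV ?pnatr_eq0 // subrr H1 H'0.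
  by apply: continuous_subspaceT; exact: cont_reparam.
Qed.

Lemma homotopic_compl (X Y Z : topologicalType) (f g : X -> Y) (h : Y -> Z) :
  continuous h -> homotopic R f g -> homotopic R (h \o f) (h \o g).
Proof.
move=> ch /homotopicP[H [cH H0 H1]]; apply/homotopicP.
exists (h \o H); split=> [|x|x] /=; rewrite ?H0 ?H1 //.
exact: continuous_compose cH ch.
Qed.

Lemma homotopic_compr (X Y Z : topologicalType) (f g : Y -> Z) (h : X -> Y) :
  continuous h -> homotopic R f g -> homotopic R (f \o h) (g \o h).
Proof.
move=> ch /homotopicP[H [cH H0 H1]]; apply/homotopicP.
exists (fun p => H (h p.1, p.2)); split=> [|x|x] /=; rewrite ?H0 ?H1 //.
apply: continuous_compose cH; apply: continuous_pair.
  exact: continuous_compose (@continuous_fst _ _) ch.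
exact: continuous_snd.
Qed.

Lemma homotopy_equivalent_trans (X Y Z : topologicalType) :
  homotopy_equivalent R X Y -> homotopy_equivalent R Y Z ->
  homotopy_equivalent R X Z.
Proof.
(* Used twice, the second time with forward and backward maps exchanged. *)
have comp_id (A B C : topologicalType) (f : A -> B) (g : B -> A)
    (f' : B -> C) (g' : C -> B) : continuous f -> continuous g ->
    homotopic R (g \o f) idfun -> homotopic R (g' \o f') idfun ->
    homotopic R ((g \o g') \o (f' \o f)) idfun.
  move=> cf cg gf g'f'; apply: homotopic_trans gf.
  exact: (homotopic_compl cg (homotopic_compr cf g'f')).
move=> [f [g [cf cg gf fg]]] [f' [g' [cf' cg' gf' fg']]].
exists (f' \o f), (g \o g'); split.
- exact: continuous_compose cf cf'.
- exact: continuous_compose cg' cg.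
- exact: comp_id.
- exact: comp_id.
Qed.

(** The contraction of [Y] to [y], composed with [f] before and [g] after, takes [g \o f] to the
    constant map at [g y]. *)
Lemma homotopy_equivalent_contractible (X Y : topologicalType) :
  homotopy_equivalent R X Y -> contractible R Y -> contractible R X.
Proof.
move=> [f [g [cf cg gf _]]] [y idy]; exists (g y).
apply: homotopic_trans (homotopic_sym gf) _.
exact: (homotopic_compl cg (homotopic_compr cf idy)).
Qed.

End Continuity.

(** * Deformations of realizations *)

Section Realization.
Context {R : realType}.

Lemma continuous_sum (T : topologicalType) (I : finType) (F : I -> T -> R) :
  (forall i, continuous (F i)) -> continuous (fun t => \sum_i F i t).
Proof.
by move=> cF; apply: continuous_big => //; exact: add_continuous.
Qed.

Definition vertex_support (V : finType) (x : V -> R) : {set V} :=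
  [set v | x v != 0]%SET.

Section Points.
Variables (V : finType) (K : scomplex V).

Definition point_of (x : {ptws V -> R}) (Kx : realization_set K x) :
    realization R K :=
  exist _ x (mem_set Kx).

Lemma realizationP (x : realization R K) : realization_set K (val x).
Proof. exact: set_mem (valP x). Qed.

Lemma coordinate_ge0 (x : realization R K) v : 0 <= val x v.
Proof. by have [] := realizationP x. Qed.

Lemma sum_coordinates (x : realization R K) : \sum_v val x v = 1.
Proof. by have [] := realizationP x. Qed.

Lemma support_simplex (x : realization R K) :
  vertex_support (val x) \in (K : {set {set V}}).
Proof. by have [] := realizationP x. Qed.

End Points.

(** The straight-line homotopy stays in [K]: a convex combination of [f t] and [g t] is supported in
    the union of their supports, which is a simplex. *)
Lemma contiguous_homotopic (T : topologicalType) (V : finType) (K : scomplex V)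
    (f g : T -> realization R K) :
  continuous f -> continuous g ->
  (forall t, vertex_support (val (f t)) :|: vertex_support (val (g t)) \in
     (K : {set {set V}}))%SET ->
  homotopic R f g.
Proof.
move=> cf cg fgK; apply/homotopicP.
pose h (p : T * R) : {ptws V -> R} := fun v =>
  (1 - clamp p.2) * val (f p.1) v + clamp p.2 * val (g p.1) v.
have Kh p : realization_set K (h p).
  split=> [v||].
  - apply: addr_ge0; apply: mulr_ge0; rewrite ?coordinate_ge0 ?clamp_ge0 //.
    by rewrite subr_ge0 clamp_le1.
  - by rewrite big_split -!big_distrr /= !sum_coordinates !mulr1 subrK.
  - apply: (simplices_sub (fgK p.1)); apply/fintype.subsetP => v.
    rewrite !inE; apply: contraR; rewrite negb_or !negbK => /andP[/eqP fv /eqP gv].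
    by rewrite /h fv gv !mulr0 addr0.
exists (fun p => point_of (Kh p)); split=> [|t|t].
- apply: continuous_into_realization => v.
  have cv (k : T -> realization R K) : continuous k ->
      continuous (fun p : T * R => val (k p.1) v : R).
    move=> ck; apply: continuous_compose (@continuous_coordinate _ _ K v).
    exact: continuous_compose (@continuous_fst _ _) ck.
  have cc : continuous (fun p : T * R => clamp p.2).
    exact: continuous_compose (@continuous_snd _ _) clamp_continuous.
  move=> p; apply: cvgD; apply: cvgM; [|exact: cv|exact: cc|exact: cv].
  by apply: cvgB; [exact: cvg_cst|exact: cc].
- apply/val_inj/funext => v /=.
  by rewrite /h /= clampE ?lexx ?ler01 // subr0 mul1r mul0r addr0.
- apply/val_inj/funext => v /=.
  by rewrite /h /= clampE ?lexx ?ler01 // subrr mul1r mul0r add0r.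
Qed.

Lemma sum_delta (V : finType) (u : V) : \sum_v (v == u)%:R = 1 :> R.
Proof.
by rewrite (bigD1 u) //= eqxx big1 ?addr0 // => v /negPf->.
Qed.

(** Adding the apex [u] to the support of any point gives a simplex, so the identity is contiguous
    to the constant map at [u]. *)
Lemma cone_contractible (V : finType) (K : scomplex V) (u : V) :
  [set u]%SET \in (K : {set {set V}}) ->
  (forall S, S \in (K : {set {set V}}) -> (u |: S)%SET \in (K : {set {set V}})) ->
  contractible R (realization R K).
Proof.
move=> uK coneK; pose e : {ptws V -> R} := fun v => (v == u)%:R.
have supp_e : vertex_support e = [set u]%SET.
  by apply/setP => v; rewrite !inE /e; case: (v == u); rewrite ?oner_neq0 ?eqxx.
have Ke : realization_set K e.
  split=> [v||]; first by rewrite ler0n.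
    exact: sum_delta.
  by have := uK; rewrite -supp_e.
exists (point_of Ke); apply: contiguous_homotopic.
- by move=> x U.
- exact: cst_continuous.
- by move=> x; rewrite /= supp_e finset.setUC; apply: coneK; exact: support_simplex.
Qed.

Lemma dominated_deletion (V : finType) (K L : scomplex V) (u v : V) :
  u != v ->
  (forall S : {set V}, (S \in (L : {set {set V}})) =
     (S \in (K : {set {set V}})) && (v \notin S)) ->
  (forall S : {set V}, S \in (K : {set {set V}}) -> v \in S ->
     (u |: S)%SET \in (K : {set {set V}})) ->
  homotopy_equivalent R (realization R K) (realization R L).
Proof.
move=> uv LK domK.
(* All the weight of [v] goes to [u]; the total is unchanged because the two indicators have equal
   sums. *)
pose h (x : {ptws V -> R}) : {ptws V -> R} := fun w =>
  x w + x v * ((w == u)%:R - (w == v)%:R).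
have hv x : h x v = 0.
  by rewrite /h eqxx eq_sym (negPf uv) sub0r mulrN1 subrr.
have h_id (x : {ptws V -> R}) : x v = 0 -> h x = x.
  by move=> xv; apply/funext => w; rewrite /h xv mul0r addr0.
(* If [v] carries weight, both supports lie in the support of [x] with [u] added, a simplex by
   domination; otherwise [h] fixes [x]. This makes [h] contiguous to the identity. *)
have supp_hU (x : realization R K) :
    (vertex_support (h (val x)) :|: vertex_support (val x))%SET \in (K : {set {set V}}).
  have [xv|xv] := eqVneq (val x v : R) 0.
    by rewrite h_id // finset.setUid; exact: support_simplex.
  have vx : v \in vertex_support (val x) by rewrite inE.
  apply: (simplices_sub (domK _ (support_simplex x) vx)).
  apply/fintype.subsetP => w; rewrite !inE; have [->//|wu] := eqVneq w u.
  case/orP => //; apply: contraNN => /eqP xw.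
  rewrite /h xw (negPf wu); have [wv|] := eqVneq w v.
    by rewrite -wv xw mul0r addr0.
  by rewrite subrr mulr0 addr0.
have Lh (x : realization R K) : realization_set L (h (val x)).
  split=> [w||].
  - rewrite /h; have := coordinate_ge0 x; have [->|wv] := eqVneq w v => x0.
      by rewrite eq_sym (negPf uv) sub0r mulrN1 subrr.
    by rewrite subr0 addr_ge0 // mulr_ge0.
  - rewrite big_split /= sum_coordinates -big_distrr /= sumrB !sum_delta.
    by rewrite subrr mulr0 addr0.
  - rewrite LK; apply/andP; split; last by rewrite inE hv eqxx.
    by apply: (simplices_sub (supp_hU x)); exact: finset.subsetUl.
have KL (x : realization R L) : realization_set K (val x).
  have [x0 x1] := realizationP x.
  by rewrite LK => /andP[xK _]; split.
pose f x := point_of (Lh x); pose g x := point_of (KL x).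
have cf : continuous f.
  apply: continuous_into_realization => w x.
  have cx v' := @continuous_coordinate R V K v' x.
  by apply: (cvgD (cx w)); apply: (cvgM (cx v)); exact: cvg_cst.
have cg : continuous g.
  by apply: continuous_into_realization => w; exact: continuous_coordinate.
exists f, g; split=> //.
  apply: contiguous_homotopic => //; first exact: continuous_compose cf cg.
  by move=> x U.
have -> : f \o g = idfun.
  apply/funext => x; apply/val_inj => /=; apply: h_id.
  have := support_simplex x; rewrite LK => /andP[_].
  by rewrite inE negbK => /eqP.
by apply: homotopic_refl => x U.
Qed.

End Realization.

(** * Boundaries of cross-polytopes *)

Section CrossPolytope.
Context {R : realType}.
Variables (V : finType) (K : scomplex V) (d : nat) (p : 'I_d.+1 -> bool -> V).
Hypothesis p_inj : forall i j b c, p i b = p j c -> i = j /\ b = c.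
(** [K] is the boundary complex of a cross-polytope with d + 1 axes, [p i true] and [p i false]
    being the two ends of the i-th axis. Elements of [V] outside the image of [p] lie in no
    simplex. *)
Hypothesis KP : forall S : {set V}, S \in (K : {set {set V}}) <->
  (forall v, v \in S -> exists i b, v = p i b) /\
  (forall i, ~~ ((p i true \in S) && (p i false \in S))).

(** Extension by zero off the image of [p], in the form of a finite sum so that continuity can be
    checked on the summands. *)
Definition assemble (c : 'I_d.+1 -> bool -> R) : {ptws V -> R} :=
  fun v => \sum_i \sum_b (v == p i b)%:R * c i b.

Lemma assemble_p c i b : assemble c (p i b) = c i b.
Proof.
rewrite /assemble (bigD1 i) //= (bigD1 b) //= eqxx mul1r.
rewrite big1 => [|b' b'b]; last first.
  by case: eqP => [/p_inj[_ bb']|_]; [rewrite bb' eqxx in b'b|rewrite mul0r].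
rewrite big1 ?addr0 // => j ji; rewrite big1 // => b' _.
by case: eqP => [/p_inj[ij _]|_]; [rewrite ij eqxx in ji|rewrite mul0r].
Qed.

Lemma assemble_neq0 c v : assemble c v != 0 -> exists i b, v = p i b.
Proof.
apply: contraPP => vp; apply/negP; rewrite negbK; apply/eqP.
rewrite /assemble big1 // => i _; rewrite big1 // => b _.
case: eqP => [vib|]; rewrite ?mul0r //.
by case: vp; exists i, b.
Qed.

Lemma sum_assemble c : \sum_v assemble c v = \sum_i \sum_b c i b.
Proof.
rewrite exchange_big; apply: eq_bigr => i _.
rewrite exchange_big; apply: eq_bigr => b _.
by rewrite -big_distrl /= sum_delta mul1r.
Qed.

(** Points of [K] vanish off the image of [p], so their weights on that image determine them. *)
Lemma assembleK (x : realization R K) :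
  assemble (fun i b => val x (p i b)) = val x.
Proof.
have [/(_ _ _)suppx _] := (KP _).1 (support_simplex x).
apply/funext => v; have [xv|xv] := eqVneq (val x v : R) 0; last first.
  by have [|i [b ->]] := suppx v; rewrite ?inE // assemble_p.
rewrite xv; apply/eqP; apply: contra_eqT xv => xv.
by have [i [b vib]] := assemble_neq0 xv; move: xv; rewrite vib assemble_p.
Qed.

(** The coordinate along the i-th axis when its ends are placed at 1 and -1. *)
Definition difference (x : realization R K) (i : 'I_d.+1) : R :=
  val x (p i true) - val x (p i false).

(* On a simplex, one of the two coordinates vanishes. *)
Lemma norm_difference (x : realization R K) i :
  `|difference x i| = val x (p i true) + val x (p i false).
Proof.
have [_ /(_ i)] := (KP _).1 (support_simplex x).
rewrite !inE negb_and !negbK /difference.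
have := coordinate_ge0 x (p i true); have := coordinate_ge0 x (p i false).
move=> x0 x1 /orP[] /eqP->.
  by rewrite sub0r normrN add0r ger0_norm.
by rewrite subr0 addr0 ger0_norm.
Qed.

Lemma sum_norm_difference (x : realization R K) : \sum_i `|difference x i| = 1.
Proof.
rewrite -(sum_coordinates x) -(assembleK x) sum_assemble.
by apply: eq_bigr => i _; rewrite big_bool norm_difference.
Qed.

Definition euclidean_norm (y : 'I_d.+1 -> R) : R :=
  Num.sqrt (\sum_i y i ^+ 2).

(** This and [sum_norm_gt0] keep the divisors nonzero when rescaling between the l1 and the
    Euclidean unit spheres. *)
Lemma sum_sqr_gt0 (y : 'I_d.+1 -> R) :
  0 < \sum_i `|y i| -> 0 < \sum_i y i ^+ 2.
Proof.
move=> y1; rewrite lt_neqAle sumr_ge0 ?andbT; last by move=> i _; exact: sqr_ge0.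
apply: contraL y1 => /eqP/esym/eqP.
rewrite psumr_eq0 => [/allP y0|i _]; last exact: sqr_ge0.
rewrite big1 ?ltxx // => i _.
by have := y0 i; rewrite mem_index_enum sqrf_eq0 => /(_ isT)/eqP->; rewrite normr0.
Qed.

Lemma sum_norm_gt0 (y : 'I_d.+1 -> R) :
  0 < \sum_i y i ^+ 2 -> 0 < \sum_i `|y i|.
Proof.
move=> y1; rewrite lt_neqAle sumr_ge0 ?andbT; last by move=> i _; exact: normr_ge0.
apply: contraL y1 => /eqP/esym/eqP.
rewrite psumr_eq0 => [/allP y0|i _]; last exact: normr_ge0.
rewrite big1 ?ltxx // => i _.
by have := y0 i; rewrite mem_index_enum normr_eq0 => /(_ isT)/eqP->; rewrite expr0n.
Qed.

Lemma euclidean_norm_difference_gt0 x : 0 < euclidean_norm (difference x).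
Proof.
by rewrite sqrtr_gt0; apply: sum_sqr_gt0; rewrite sum_norm_difference ltr01.
Qed.

Definition sphere_set : set 'rV[R]_d.+1 :=
  [set x | \sum_(i < d.+1) x ord0 i ^+ 2 = 1].

Lemma normalized_on_sphere x :
  sphere_set (\row_i (difference x i / euclidean_norm (difference x))).
Proof.
have n0 := euclidean_norm_difference_gt0 x.
rewrite /sphere_set /=; under eq_bigr do rewrite mxE exprMn.
rewrite -big_distrl /= exprVn sqr_sqrtr ?divff //.
  by rewrite gt_eqF // -sqrtr_gt0.
by rewrite ltW // -sqrtr_gt0.
Qed.

Definition to_sphere (x : realization R K) : sphere R d :=
  exist (fun y => y \in sphere_set) _ (mem_set (normalized_on_sphere x)).

Lemma sphereP (y : sphere R d) : \sum_i val y ord0 i ^+ 2 = 1.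
Proof. exact: set_mem (valP y). Qed.

Lemma sphere_norm1_gt0 (y : sphere R d) : 0 < \sum_i `|val y ord0 i|.
Proof. by apply: sum_norm_gt0; rewrite sphereP ltr01. Qed.

(* The positive (for [b = true]) or negative part of the i-th coordinate,
   rescaled to the sphere of the l1 norm. *)
Definition signed_part (y : sphere R d) (i : 'I_d.+1) (b : bool) : R :=
  (`|val y ord0 i| + (if b then val y ord0 i else - val y ord0 i)) / 2 /
  \sum_j `|val y ord0 j|.

Lemma assemble_signed_part (y : sphere R d) :
  realization_set K (assemble (signed_part y)).
Proof.
have n0 := sphere_norm1_gt0 y; split=> [v||].
- apply: sumr_ge0 => i _; apply: sumr_ge0 => b _.
  rewrite mulr_ge0 ?ler0n // /signed_part !mulr_ge0 ?invr_ge0 ?ler0n ?(ltW n0) //.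
  move: (val y ord0 i : R) => t.
  have := ler_norm t; have := ler_norm (- t); rewrite normrN => ? ?.
  by case: b; lra.
- rewrite sum_assemble; under eq_bigr do rewrite big_bool /signed_part /= -mulrDl.
  rewrite -big_distrl /= (_ : \sum_i _ = \sum_i `|val y ord0 i|) ?divff ?gt_eqF //.
  by apply: eq_bigr => i _; field.
- apply/KP; split=> [v|i]; first by rewrite inE => /assemble_neq0.
  rewrite !inE !assemble_p /signed_part -negb_or negbK !mulf_eq0.
  (* The positive and the negative part of a real number are never both nonzero. *)
  by case: (ger0P (val y ord0 i)) => _; rewrite ?subrr ?addNr ?eqxx ?orbT.
Qed.

Definition of_sphere (y : sphere R d) : realization R K :=
  point_of (assemble_signed_part y).

(** Since [difference x] has l1 norm 1, its Euclidean normalization has l1 norm 1 / N, with N its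
    Euclidean norm. Dividing by this restores [difference x], whose signed parts are the two weights
    on each axis. *)
Lemma to_sphereK : cancel to_sphere of_sphere.
Proof.
move=> x; apply/val_inj => /=; rewrite -[RHS]assembleK.
congr assemble; apply/funext => i; apply/funext => b.
have n0 := euclidean_norm_difference_gt0 x.
rewrite /signed_part /=.
rewrite (eq_bigr (fun j =>
  `|difference x j| / euclidean_norm (difference x))); last first.
  by move=> j _; rewrite mxE normrM normfV (gtr0_norm n0).
rewrite -big_distrl /= sum_norm_difference mxE normrM normfV (gtr0_norm n0).
set N := euclidean_norm _ in n0 *; rewrite norm_difference /difference.
case: b => /=; move: (val x (p i true) : R) (val x (p i false) : R) => s t.
  by field; rewrite gt_eqF.
by field; rewrite gt_eqF.
Qed.

(** The signed coordinates of [of_sphere y] are those of [y] divided by its l1 norm; as [y] has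
    Euclidean norm 1, normalizing them gives [y] back. *)
Lemma of_sphereK : cancel of_sphere to_sphere.
Proof.
move=> y; apply/val_inj/rowP => i /=; rewrite mxE.
have n0 := sphere_norm1_gt0 y; set n := \sum_i _ in n0.
have dif : difference (of_sphere y) = (fun i => val y ord0 i / n).
  apply/funext => j; rewrite /difference /= !assemble_p /signed_part -/n.
  by field; rewrite gt_eqF.
rewrite dif /euclidean_norm.
under eq_bigr do rewrite exprMn.
rewrite -big_distrl /= sphereP mul1r sqrtr_sqr normfV gtr0_norm //.
by rewrite invrK divfK // gt_eqF.
Qed.

Lemma continuous_to_sphere : continuous to_sphere.
Proof.
have cdif i : continuous (difference ^~ i).
  move=> x; have cx v := @continuous_coordinate R V K v x.
  exact: (cvgB (cx _) (cx _)).
have cnorm : continuous (fun x => euclidean_norm (difference x)).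
  apply: continuous_compose (@sqrt_continuous R).
  apply: continuous_sum => i.
  exact: continuous_compose (cdif i) (@exprn_continuous R 2).
apply: continuous_into_set_type; apply: continuous_into_rV => i.
rewrite (_ : (fun _ => _) =
  (fun x => difference x i / euclidean_norm (difference x))); last first.
  by apply/funext => x; rewrite mxE.
move=> x; have nx : euclidean_norm (difference x) != 0.
  by rewrite gt_eqF // euclidean_norm_difference_gt0.
exact: (cvgM (cdif i x) (cvgV nx (cnorm x))).
Qed.

Lemma continuous_of_sphere : continuous of_sphere.
Proof.
have cy i : continuous (fun y : sphere R d => val y ord0 i : R).
  apply: continuous_compose (@coord_continuous R 1 d.+1 ord0 i).
  exact: continuous_set_val.
have cny i : continuous (fun y : sphere R d => `|val y ord0 i| : R).
  by apply: continuous_compose (cy i) _; exact: norm_continuous.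
apply: continuous_into_realization => v.
apply: continuous_sum => i; apply: continuous_sum => b y.
have ny : \sum_j `|val y ord0 j| != 0 by rewrite gt_eqF // sphere_norm1_gt0.
have csy : continuous (fun y : sphere R d =>
    if b then val y ord0 i else - val y ord0 i : R).
  by case: b => // z; exact: cvgN (cy i z).
have cny' := continuous_sum cny.
by apply: (cvgM (cvg_cst _) (cvgM (cvgM (cvgD (cny i y) (csy y)) (cvg_cst _))
  (cvgV ny (cny' y)))).
Qed.

Lemma cross_polytope_sphere :
  homotopy_equivalent R (realization R K) (sphere R d).
Proof.
exists to_sphere, of_sphere; split.
- exact: continuous_to_sphere.
- exact: continuous_of_sphere.
- rewrite (_ : _ \o _ = idfun); last exact/funext/to_sphereK.
  by apply: homotopic_refl => x U.
- rewrite (_ : _ \o _ = idfun); last exact/funext/of_sphereK.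
  by apply: homotopic_refl => x U.
Qed.

End CrossPolytope.

(** * Independence complexes of forests *)

Section RankedForest.
Variables (G : sgraph) (rank : G -> nat).
Hypothesis adj_rank : forall u v : G, adj u v -> rank u != rank v.
Hypothesis parent_uniq : forall u v w : G, adj u v -> adj u w ->
  (rank v < rank u)%N -> (rank w < rank u)%N -> v = w.

Definition nbrs (W : {set G}) (u : G) : {set G} := [set v in W | adj u v]%SET.

Lemma fold_pair (W : {set G}) (w0 : G) :
  w0 \in W -> (1 < #|nbrs W w0|)%N ->
  exists u v, [/\ u \in W, v \in W, u != v & nbrs W u \subset nbrs W v].
Proof.
move=> w0W dw0.
have w0P : (w0 \in W) && (1 < #|nbrs W w0|)%N by rewrite w0W.
have [w /andP[wW dw] wmax] :=
  @arg_maxnP _ w0 (fun w => (w \in W) && (1 < #|nbrs W w|)%N) rank w0P.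
have [x [y [xN yN xy]]] : exists x y, [/\ x \in nbrs W w, y \in nbrs W w & x != y].
  by move/card_gt1P: dw => [x [y [? ? ?]]]; exists x, y.
(* No neighbour of [w] has equal rank and at most one has smaller rank, so [x] or [y] lies above
   [w]. *)
wlog rx : x y xN yN xy / (rank w < rank x)%N => [hw|].
  move: (xN) (yN); rewrite !inE => /andP[_ wx] /andP[_ wy].
  have := adj_rank wx; have := adj_rank wy.
  case: (ltngtP (rank w) (rank x)) => // rx _ _; first exact: (hw x y).
  case: (ltngtP (rank w) (rank y)) => // ry.
    by apply: (hw y x) => //; rewrite eq_sym.
    by rewrite (parent_uniq wx wy rx ry) eqxx in xy.
  by have := adj_rank wy; rewrite ry eqxx.
move: (xN) (yN); rewrite !inE => /andP[xW wx] /andP[yW wy].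
exists x, y; split=> //; apply/fintype.subsetP => z zN.
(* As [x] ranks above [w], maximality of [w] denies it two neighbours. Its only neighbour in [W] is
   then [w], which is also adjacent to [y]. *)
have dx : (#|nbrs W x| <= 1)%N.
  rewrite leqNgt; apply/negP => dx.
  by have := leq_trans rx (wmax x _); rewrite xW dx ltnn => /(_ isT).
have wN : w \in nbrs W x by rewrite inE wW adj_sym.
by rewrite (card_le1_eqP dx _ _ wN zN) inE wW adj_sym.
Qed.

Lemma independentP (S : {set G}) :
  reflect {in S &, forall u v, ~~ adj u v} (independent S).
Proof.
apply: (iffP forall_inP) => [h u v uS vS|h u uS].
  by have /forall_inP := h u uS; apply.
by apply/forall_inP => v vS; exact: h.
Qed.

Lemma independentU1 (u : G) (S : {set G}) :
  independent (u |: S)%SET =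
  independent S && [forall v in S, ~~ adj u v].
Proof.
apply/independentP/andP => [h|[/independentP h /forall_inP hu]].
  split; last by apply/forall_inP => v vS; apply: h; rewrite !inE ?eqxx ?vS ?orbT.
  by apply/independentP => v w vS wS; apply: h; rewrite !inE ?vS ?wS ?orbT.
move=> v w; rewrite !inE => /predU1P[->|vS] /predU1P[->|wS].
- by rewrite adj_irrefl.
- exact: hu.
- by rewrite adj_sym; exact: hu.
- exact: h.
Qed.

(** Induced subgraphs keep the vertex type [G], so that deleting a vertex only shrinks [W]. *)
Definition induced_independence (W : {set G}) : {set {set G}} :=
  [set S : {set G} | (S \subset W) && independent S]%SET.

Lemma induced_independence_sub W (A B : {set G}) :
  B \in induced_independence W -> A \subset B -> A \in induced_independence W.
Proof.
rewrite !inE => /andP[BW iB] AB; rewrite (fintype.subset_trans AB BW) /=.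
by have := @independent_sub G A B; rewrite !inE; apply.
Qed.

Definition induced_complex (W : {set G}) : scomplex G :=
  SComplex (@induced_independence_sub W).

Section Types.
Context {R : realType}.

Lemma isolated_contractible (W : {set G}) (u : G) :
  u \in W -> nbrs W u = finset.set0 ->
  contractible R (realization R (induced_complex W)).
Proof.
move=> uW Nu; have uS S : S \in induced_independence W ->
    (u |: S)%SET \in induced_independence W.
  rewrite !inE => /andP[SW iS]; rewrite finset.subUset finset.sub1set uW SW /=.
  rewrite independentU1 iS /=; apply/forall_inP => v vS.
  have := finset.in_set0 v; rewrite -Nu inE (fintype.subsetP SW) //= => ->//.
apply: (@cone_contractible _ _ _ u) => //.
rewrite -[[set u]%SET]finset.setU0; apply: uS; rewrite inE finset.sub0set.
by apply/independentP => x y; rewrite inE.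
Qed.

(** In an independent set containing [v], a neighbour of [u] would also be a neighbour of [v]; hence
    [u] can be added, and [v] is dominated by [u]. *)
Lemma fold_equivalence (W : {set G}) (u v : G) :
  u \in W -> u != v -> nbrs W u \subset nbrs W v ->
  homotopy_equivalent R (realization R (induced_complex W))
    (realization R (induced_complex (W :\ v)%SET)).
Proof.
move=> uW uv Nuv; apply: (@dominated_deletion _ _ _ _ u v) => // S.
  by rewrite !inE finset.subsetD1 -!andbA [independent S && _]andbC.
rewrite !inE => /andP[SW iS] vS.
rewrite finset.subUset finset.sub1set uW SW independentU1 iS /=.
apply/forall_inP => w wS; apply: contraT; rewrite negbK => uw.
have : w \in nbrs W v by rewrite (fintype.subsetP Nuv) // inE uw (fintype.subsetP SW).
by rewrite inE => /andP[_ vw]; have/independentP/(_ v w vS wS) := iS; rewrite vw.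
Qed.

Lemma matching_sphere (W : {set G}) :
  W != finset.set0 -> (forall u, u \in W -> #|nbrs W u| = 1%N) ->
  exists d, homotopy_equivalent R (realization R (induced_complex W)) (sphere R d).
Proof.
move=> W0 N1.
have [w0 w0W] := finset.set0Pn _ W0.
(* The default [u] is never reached on [W], where exactly one neighbour exists. *)
pose mate u := odflt u [pick v in nbrs W u].
have mateP u : u \in W -> nbrs W u = [set mate u]%SET.
  move=> uW; have /eqP/cards1P[v Nv] := N1 u uW.
  rewrite /mate Nv; case: pickP => [x|/(_ v)]; rewrite inE ?eqxx //.
  by move=> /eqP->.
have mateW u : u \in W -> (mate u \in W) && adj u (mate u).
  by move=> /mateP Nu; have := set11 (mate u); rewrite -Nu inE.
have mate_uniq u v : u \in W -> v \in W -> adj u v -> v = mate u.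
  move=> uW vW uv; apply/set1P; rewrite -mateP // inE vW.
  exact: uv.
have mateK u : u \in W -> mate (mate u) = u.
  move=> uW; have /andP[mW um] := mateW u uW.
  by apply/esym/mate_uniq => //; rewrite adj_sym.
(* One representative per edge of the matching: its end of lower rank. *)
pose I := [set u in W | (rank u < rank (mate u))%N]%SET.
have cardI : (0 < #|I|)%N.
  apply/card_gt0P; have /andP[mW um] := mateW w0 w0W.
  case: (ltngtP (rank w0) (rank (mate w0))) => r.
  - by exists w0; rewrite inE w0W.
  - by exists (mate w0); rewrite inE mW mateK.
  - by have := adj_rank um; rewrite r eqxx.
(* Each edge is one axis, and the sphere has dimension one less than the number of axes. *)
exists #|I|.-1; pose cI := prednK cardI.
pose e (i : 'I_#|I|.-1.+1) : G := enum_val (cast_ord cI i).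
have eI i : e i \in I by exact: enum_valP.
have eW i : e i \in W by have := eI i; rewrite inE => /andP[].
have e_inj : injective e by move=> i j /enum_val_inj/cast_ord_inj.
have e_surj u : u \in I -> exists i, u = e i.
  move=> uI; exists (cast_ord (esym cI) (enum_rank_in uI u)).
  by rewrite /e cast_ordKV enum_rankK_in.
pose p i (b : bool) := if b then e i else mate (e i).
(* Two lower ends cannot be mates, since each would rank below the other. *)
have eNmate i j : e i <> mate (e j).
  move=> eij; have := eI i; have := eI j; rewrite !inE eij mateK //.
  move=> /andP[_ r] /andP[_].
  by rewrite ltnNge (ltnW r).
apply: (@cross_polytope_sphere _ _ _ _ p).
- move=> i j [] [] /=.
  + by move=> /e_inj.
  + by move=> /eNmate.
  + by move=> /esym/eNmate.
  + by move=> h; have := mateK _ (eW i); rewrite h mateK // => /e_inj.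
- move=> S; rewrite inE; split=> [/andP[/fintype.subsetP SW /independentP iS]|[Sp Sx]].
  + split=> [v /SW vW|i].
      have /andP[mW vm] := mateW v vW.
      case: (ltngtP (rank v) (rank (mate v))) => r.
      * have [|i vi] := e_surj v; first by rewrite inE vW.
        by exists i, true.
      * have [|i vi] := e_surj (mate v); first by rewrite inE mW mateK.
        by exists i, false; rewrite /= -vi mateK.
      * by have := adj_rank vm; rewrite r eqxx.
    apply/negP => /andP[/= eS mS]; have := iS _ _ eS mS.
    by have /andP[_ ->] := mateW _ (eW i).
  + have SW : {subset S <= W}.
      by move=> v /Sp[i [[] ->]] //=; have /andP[] := mateW _ (eW i).
    apply/andP; split; first exact/fintype.subsetP.
    apply/independentP => u v uS vS; apply/negP => uv.
    have uW := SW _ uS; have vW := SW _ vS.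
    (* The second end of an edge is the mate of the first, so an edge inside [S] would be an
       opposite pair, which [Sx] excludes. *)
    have vm := mate_uniq _ _ uW vW uv.
    have [i [b ub]] := Sp _ uS; have := Sx i; rewrite /=.
    case: b ub => /= ub; first by rewrite -ub uS -vm vS.
    by rewrite -ub uS -[e i]mateK // -ub -vm vS.
Qed.

Lemma forest_homotopy_type (W : {set G}) : W != finset.set0 ->
  contractible R (realization R (induced_complex W)) \/
  exists d, homotopy_equivalent R (realization R (induced_complex W)) (sphere R d).
Proof.
have [n] := ubnP #|W|; elim: n W => // n IHn W ltWn W0.
have [/existsP[w /andP[wW dw]]|] := boolP [exists w in W, 1 < #|nbrs W w|]%N.
  have [u [v [uW vW uv Nuv]]] := fold_pair wW dw.
  have eqv := fold_equivalence uW uv Nuv.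
  (* The vertex [u] survives, so the induction never reaches the empty set, whose realization has no
     points. *)
  have W'0 : (W :\ v)%SET != finset.set0.
    by apply/finset.set0Pn; exists u; rewrite !inE uv.
  have ltW'n : (#|W :\ v|%SET < n)%N by rewrite (cardsD1 v) vW in ltWn.
  have [c|[d s]] := IHn _ ltW'n W'0.
  - by left; exact: homotopy_equivalent_contractible eqv c.
  - by right; exists d; exact: homotopy_equivalent_trans eqv s.
rewrite negb_exists_in => /forall_inP le1.
have [/existsP[u /andP[uW /eqP Nu]]|] := boolP [exists u in W, nbrs W u == finset.set0].
  by left; exact: isolated_contractible Nu.
rewrite negb_exists_in => /forall_inP ge1; right; apply: matching_sphere => // u uW.
by apply/eqP; rewrite eqn_leq leqNgt le1 //= card_gt0 ge1.
Qed.

End Types.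
End RankedForest.

(** * The rank function on a wedge of two paths *)

Section WedgeRank.
Variables (m n : nat) (a1 : path_graph m) (a2 : path_graph n).

(** The absolute difference: subtraction is truncated, so at least one summand is zero. *)
Definition path_distance (i j : nat) : nat := (i - j) + (j - i).

Definition wedge_rank (x : wedge_graph (path_graph m) (path_graph n) a1 a2) : nat :=
  match x with
  | None => 0
  | Some (inl u) => path_distance (val u : 'I_m) (a1 : 'I_m)
  | Some (inr u) => path_distance (val u : 'I_n) (a2 : 'I_n)
  end.

Lemma ord_neq_nat k (i j : 'I_k) : i != j -> nat_of_ord i <> nat_of_ord j.
Proof. by move=> /eqP ij eij; apply: ij; exact: ord_inj. Qed.

(** Adjacent positions on a path differ by one, so their distances to the wedge point differ by
    exactly one. *)
Lemma wedge_adj_rank (x y : wedge_graph _ _ a1 a2) :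
  adj x y -> wedge_rank x != wedge_rank y.
Proof.
by case: x y => [[[u /= /ord_neq_nat hu]|[u /= /ord_neq_nat hu]]|]
  [[[v /= /ord_neq_nat hv]|[v /= /ord_neq_nat hv]]|] //=;
  rewrite /path_adj /path_distance; lia.
Qed.

(** The only neighbour nearer to the wedge point is the next vertex towards it on the same path. *)
Lemma wedge_parent_uniq (x y z : wedge_graph _ _ a1 a2) :
  adj x y -> adj x z -> (wedge_rank y < wedge_rank x)%N ->
  (wedge_rank z < wedge_rank x)%N -> y = z.
Proof.
case: x y z => [[[u /= hu]|[u /= hu]]|] //=
  [[[v /= hv]|[v /= hv]]|] //= [[[w /= hw]|[w /= hw]]|] //=;
  move: (ord_neq_nat hu); rewrite ?/path_adj /path_distance => hu' h1 h2 h3 h4.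
- congr (Some (inl _)); apply/val_inj/val_inj => /=.
  by move: (ord_neq_nat hv) (ord_neq_nat hw); lia.
(* Here [x] is adjacent to the wedge point, so [y] would have rank 0 without being the wedge
   point. *)
- by move: (ord_neq_nat hv); lia.
- by move: (ord_neq_nat hw); lia.
- congr (Some (inr _)); apply/val_inj/val_inj => /=.
  by move: (ord_neq_nat hv) (ord_neq_nat hw); lia.
- by move: (ord_neq_nat hv); lia.
- by move: (ord_neq_nat hw); lia.
Qed.

End WedgeRank.

Lemma scomplex_inj (V : finType) : injective (@simplices V).
Proof.
move=> [A hA] [B hB] /= eqAB; subst B.
by congr SComplex; exact: Prop_irrelevance.
Qed.

Lemma induced_complexT (G : sgraph) :
  induced_complex [set: G]%SET = independence_complex G.
Proof.
by apply/scomplex_inj/setP => S; rewrite !inE finset.subsetT.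
Qed.

Theorem theorem3p2 (R : realType) (m n : nat)
    (hm : (1 <= m)%N) (hn : (1 <= n)%N)
    (a1 : path_graph m) (a2 : path_graph n) :
  contractible R (realization R (independence_complex
    (wedge_graph (path_graph m) (path_graph n) a1 a2))) \/
  exists d : nat,
    homotopy_equivalent R (realization R (independence_complex
      (wedge_graph (path_graph m) (path_graph n) a1 a2))) (sphere R d).
Proof.
rewrite -induced_complexT.
apply: (forest_homotopy_type (@wedge_adj_rank _ _ a1 a2)
  (@wedge_parent_uniq _ _ a1 a2)).
by apply/finset.set0Pn; exists None; rewrite inE.
Qed.
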